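(* Let $n\ge3$, $1\le j\le n-1$, $A\in\mathrm{GL}(n)$, and let $K$ and $L$ be origin-symmetric convex bodies with non-empty interior in $\mathbb{R}^n$. If $K$ is the $j$-projection body of $L$, then $AK$ is the $j$-projection body of $|\det A|^{\frac{1}{n-j}}A^{-\mathrm{T}}L$. In particular, the class of $j$-projection bodies is $\mathrm{GL}(n)$ invariant.
   Context: $K$ is called the $j$-projection body of $L$ if $\mathrm{vol}_j(K|E^\perp)=\mathrm{vol}_{n-j}(L|E)$ for every $(n-j)$-dimensional linear subspace $E$ of $\mathbb{R}^n$, where $K|E$ denotes orthogonal projection onto $E$. The class of $j$-projection bodies is the closure in the Hausdorff metric of the set of all $j$-projection bodies of origin-symmetric convex bodies with non-empty interior. $A^{-\mathrm{T}}$ is the inverse transpose of $A$. *)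

(* Defs.v *)
From HB Require Import structures.
From mathcomp Require Import all_boot all_order all_algebra.
From mathcomp Require Import all_classical all_reals all_analysis.
Set Implicit Arguments. Unset Strict Implicit. Unset Printing Implicit Defensive.
Import Order.TTheory GRing.Theory Num.Theory.
Import numFieldNormedType.Exports.
Local Open Scope classical_set_scope.
Local Open Scope ring_scope.

Section Defs.
Variable R : realType.

(* Points of R^n are row vectors 'rV[R]_n; a linear map A acts by x |-> A x,
   i.e. x |-> x *m A^T on row vectors. *)

Definition enorm n (x : 'rV[R]_n) : R := Num.sqrt (\sum_(i < n) x ord0 i ^+ 2).

Definition box k (a b : 'rV[R]_k) : set 'rV[R]_k :=
  [set x | forall i, a ord0 i <= x ord0 i <= b ord0 i].

Definition lvol k (S : set 'rV[R]_k) : \bar R :=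
  ereal_inf [set v | exists (a b : nat -> 'rV[R]_k),
    [/\ (forall m i, a m ord0 i <= b m ord0 i),
        S `<=` \bigcup_m box (a m) (b m) &
        v = (\sum_(0 <= m <oo) ((\prod_(i < k) (b m ord0 i - a m ord0 i))%:E))%E]].

Definition convex_set n (K : set 'rV[R]_n) :=
  forall x y t, K x -> K y -> 0 <= t <= 1 -> K (t *: x + (1 - t) *: y).
Definition osym n (K : set 'rV[R]_n) := forall x, K x -> K (- x).
Definition os_body n (K : set 'rV[R]_n) :=
  [/\ convex_set K, compact K, osym K & (K°) !=set0].

Definition orthonormal k n (P : 'M[R]_(k, n)) := P *m P^T = 1%:M.

(* Coordinates (in the orthonormal basis given by the rows of P) of the
   orthogonal projection K|F of K onto F = row space of P. *)
Definition proj_coords k n (P : 'M[R]_(k, n)) (K : set 'rV[R]_n) : set 'rV[R]_k :=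
  [set x *m P^T | x in K].

(* vol_j(K|E^perp) = vol_(n-j)(L|E) for every (n-j)-dimensional subspace E:
   E is the row space of an orthonormal (n-j)-frame P, and E^perp is the row
   space of any orthonormal j-frame Q with P Q^T = 0. *)
Definition jproj_body n j (K L : set 'rV[R]_n) :=
  forall (P : 'M[R]_(n - j, n)) (Q : 'M[R]_(j, n)),
    orthonormal P -> orthonormal Q -> P *m Q^T = 0 ->
    lvol (proj_coords Q K) = lvol (proj_coords P L).

Definition hausdorff_le n (K M : set 'rV[R]_n) (e : R) : Prop :=
  (forall x, K x -> exists2 y, M y & enorm (x - y) <= e) /\
  (forall y, M y -> exists2 x, K x & enorm (x - y) <= e).

(* the class of j-projection bodies: Hausdorff closure (within compact convex
   sets) of the j-projection bodies of origin-symmetric convex bodies with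
   non-empty interior *)
Definition jproj_class n j (M : set 'rV[R]_n) :=
  [/\ M !=set0, compact M, convex_set M &
   forall e : R, 0 < e -> exists K L : set 'rV[R]_n,
     [/\ os_body K, os_body L, jproj_body j K L & hausdorff_le M K e]].

Definition lin_image n (A : 'M[R]_n) (K : set 'rV[R]_n) : set 'rV[R]_n :=
  [set x *m A^T | x in K].

End Defs.

(* Main.v *)
(** For an orthonormal frame [Q] of [E^perp], write [Q A = T Q'] with [Q']
orthonormal (Gram-Schmidt). The projection of [A K] onto [E^perp] is then, in
coordinates, the image under [T] of the projection of [K] onto the span of [Q'],
so its volume is multiplied by [|det T|]. In the same way [P A^-T = S P'] for a
frame [P] of [E], and [P'], [Q'] are again orthogonal to each other. In the
orthonormal bases [(P, Q)] and [(P', Q')] the matrix of [A] is block triangular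
with diagonal blocks [S^-T] and [T], hence [|det T| = |det A| |det S|], and the
factor [|det A|^(1/(n-j))] contributes exactly the missing [|det A|].

That the outer volume [lvol] scales by [|det B|] under an invertible [B] needs
no measurability: by Gaussian elimination it is enough to bound the volume of
the image of a box under a dilation of one axis and under a transvection. *)

Require Import Defs.
From HB Require Import structures.
From mathcomp Require Import all_boot all_order all_algebra.
From mathcomp Require Import all_classical all_reals all_analysis.
From mathcomp Require Import ring lra.
Import Order.TTheory GRing.Theory Num.Theory.
Import numFieldNormedType.Exports.
Local Open Scope classical_set_scope.
Local Open Scope ring_scope.
Set Implicit Arguments.
Unset Strict Implicit.
Unset Printing Implicit Defensive.

(** * Generation of the general linear group by transvections and dilations *)

Section ElementaryMatrices.
Variables (F : fieldType) (k : nat).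
Implicit Types (i l : 'I_k) (c : F) (B : 'M[F]_k).

Lemma det_elementary i l c :
  \det (1%:M + c *: delta_mx i l) = 1 + c *+ (i == l).
Proof.
wlog le_li : i l / (l <= i)%N => [H|].
  have [|/ltnW] := leqP l i; first exact: H.
  by move=> /H; rewrite eq_sym -[in LHS]det_tr linearD linearZ /= tr_scalar_mx trmx_delta.
rewrite det_trig; last first.
  apply/is_trig_mxP => a b ab; rewrite !mxE -val_eqE (ltn_eqF ab) add0r.
  case: eqP => [ai|]; case: eqP => [bl|]; rewrite /= ?mulr0 //.
  by move: ab; rewrite ai bl ltnNge le_li.
rewrite (bigD1 i) //= big1 ?mulr1 => [|a /negPf ai].
  by rewrite !mxE !eqxx mulr_natr.
by rewrite !mxE eqxx ai mulr0 addr0.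
Qed.

Section Generation.
Variable G : 'M[F]_k -> Prop.
Hypothesis G1 : G 1%:M.
Hypothesis GM : forall A B, G A -> G B -> G (A *m B).
Hypothesis Gtransv : forall i l c, i != l -> G (1%:M + c *: delta_mx i l).
Hypothesis Gdil : forall i c, c != 0 -> G (1%:M + (c - 1) *: delta_mx i i).

(** All these transvections feed one column: [delta_mx l i *m delta_mx j i] vanishes for [j != i],
    so multiplying them simply adds their off-diagonal parts. *)
Lemma gen_transv_sum i (u : 'I_k -> F) (s : seq 'I_k) :
  G (1%:M + \sum_(l <- s | l != i) u l *: delta_mx l i).
Proof.
elim: s => [|l s IHs]; first by rewrite big_nil addr0.
rewrite big_cons; case: ifP => // li.
suff -> : 1%:M + (u l *: delta_mx l i + \sum_(j <- s | j != i) u j *: delta_mx j i)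
  = (1%:M + u l *: delta_mx l i) *m
    (1%:M + \sum_(j <- s | j != i) u j *: delta_mx j i).
  by apply: GM => //; exact: Gtransv.
rewrite mulmxDl mul1mx mulmxDr mulmx1 mulmx_sumr.
rewrite [X in _ = _ + (_ + X)]big1 => [|j ji]; last first.
  by rewrite -scalemxAl -scalemxAr mul_delta_mx_0 ?scaler0 // eq_sym.
by rewrite addr0 addrAC addrA.
Qed.

Definition colrep i (v : 'cV[F]_k) : 'M[F]_k :=
  \matrix_(a, b) if b == i then v a 0 else (a == b)%:R.

(** Dilate the [i]-th axis by [v i], then add [v l / v i] times coordinate [i] to each other
    coordinate [l]: the composite sends the [i]-th basis vector to [v] and fixes the others. *)
Lemma gen_colrep i (v : 'cV[F]_k) : v i 0 != 0 -> G (colrep i v).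
Proof.
move=> vi.
suff -> : colrep i v = (1%:M + \sum_(l <- index_enum 'I_k | l != i)
    (v l 0 / v i 0) *: delta_mx l i) *m (1%:M + (v i 0 - 1) *: delta_mx i i).
  by apply: GM; [exact: gen_transv_sum|exact: Gdil].
rewrite mulmxDr mulmx1 mulmxDl mul1mx mulmx_suml addrACA -big_split /=.
under eq_bigr => l li.
  rewrite -scalemxAl -scalemxAr mul_delta_mx scalerA -scalerDl.
  rewrite -[X in (X + _) *: _]mulr1 -mulrDr addrC subrK divfK //.
  over.
apply/matrixP => a b; rewrite !mxE summxE.
under eq_bigr => l _ do rewrite !mxE.
case: (eqVneq b i) => [->|bi]; last first.
  by rewrite big1 ?andbF ?mulr0 ?addr0 // => l _; rewrite andbF mulr0.
rewrite andbT; case: (eqVneq a i) => [->|ai].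
  rewrite big1 => [|l li]; first by rewrite mulr1 addr0 addrC subrK.
  by rewrite eq_sym (negPf li) mulr0.
rewrite (bigD1 a) //= eqxx mulr1 mulr0 add0r big1 ?addr0 ?add0r // => l /andP[_].
by rewrite eq_sym => /negPf ->; rewrite mulr0.
Qed.

End Generation.

Lemma colrep_delta i (v : 'cV[F]_k) l :
  colrep i v *m delta_mx l 0 = if l == i then v else delta_mx l 0.
Proof.
rewrite -colE; apply/colP => a; rewrite !mxE.
by case: eqP => // _; rewrite !mxE eqxx andbT.
Qed.

(** Invertibility is itself one of the properties [G] covered by [gen_colrep]. *)
Lemma colrep_unitmx i (v : 'cV[F]_k) : v i 0 != 0 -> colrep i v \in unitmx.
Proof.
apply: (gen_colrep (G := fun B => B \in unitmx)).
- exact: unitmx1.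
- by move=> A B uA uB; rewrite unitmx_mul uA.
- by move=> j l c /negPf jl; rewrite unitmxE det_elementary jl addr0 unitr1.
- by move=> j c c0; rewrite unitmxE det_elementary eqxx addrC subrK unitfE.
Qed.

(** Only the first [r] columns may differ from the identity. A nonzero diagonal entry in the last of
    them lets a [colrep] factor be split off, which makes that column standard; if the entry is
    zero, one transvection first creates it. *)
Lemma unitmx_ind (G : 'M[F]_k -> Prop) :
  G 1%:M ->
  (forall A B, G A -> G B -> G (A *m B)) ->
  (forall i l c, i != l -> G (1%:M + c *: delta_mx i l)) ->
  (forall i c, c != 0 -> G (1%:M + (c - 1) *: delta_mx i i)) ->
  forall B, B \in unitmx -> G B.
Proof.
move=> G1 GM Gt Gd B uB.
(* Gaussian elimination, from the last column to the first *)
suff H r : (r <= k)%N -> forall B, B \in unitmx ->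
    (forall l, (r <= l)%N -> B *m delta_mx l 0 = delta_mx l 0 :> 'cV_k) -> G B.
  by apply: (H k) => // l; rewrite leqNgt ltn_ord.
elim: r => [_ {uB}B _ stdB|r IHr lt_rk {uB}B].
  suff -> : B = 1%:M by [].
  apply/matrixP => a l; have := stdB l isT; rewrite -colE => /colP /(_ a).
  by rewrite !mxE eqxx andbT.
pose i := Ordinal lt_rk.
have pivoted C : C \in unitmx -> C i i != 0 ->
    (forall l, (i < l)%N -> C *m delta_mx l 0 = delta_mx l 0 :> 'cV_k) -> G C.
  move=> uC Cii stdC; pose M := colrep i (col i C).
  have Mi : col i C i 0 != 0 by rewrite mxE.
  have uM : M \in unitmx by exact: colrep_unitmx.
  rewrite -(mulKVmx uM C); apply: (GM _ _); first exact: (gen_colrep G1 GM Gt Gd).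
  apply: (IHr (ltnW lt_rk)); first by rewrite unitmx_mul unitmx_inv uM.
  move=> l le_rl; rewrite -mulmxA.
  suff -> : C *m delta_mx l 0 = M *m delta_mx l 0 :> 'cV_k by rewrite mulKmx.
  rewrite colrep_delta; case: eqP => [->|/eqP li]; first by rewrite colE.
  by apply: stdC; rewrite ltn_neqAle le_rl andbT eq_sym.
move=> uB stdB.
have [l le_li Bli] : exists2 l : 'I_k, (l <= i)%N & B l i != 0.
  apply: contrapT => noPivot.
  have B0 (l : 'I_k) : (l <= i)%N -> B l i = 0.
    by move=> li; apply/eqP; apply: contrapT => /negP ?; apply: noPivot; exists l.
  (* otherwise B would fix col i B = B e_i, whose i-th entry is 0 *)
  have Bw : B *m col i B = col i B.
    rewrite {2}(matrix_sum_delta (col i B)) {1}(matrix_sum_delta (col i B)).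
    rewrite mulmx_sumr; apply: eq_bigr => l _.
    rewrite big_ord1 -scalemxAr; case: (leqP l i) => li.
      by rewrite mxE B0 // !scale0r.
    by rewrite stdB.
  move: Bw; rewrite [in RHS]colE => /(congr1 (mulmx (invmx B))).
  rewrite !mulKmx // => /colP /(_ i); rewrite !mxE B0 // !eqxx => /esym/eqP.
  by rewrite oner_eq0.
have [Bii|] := eqVneq (B i i) 0; last by move=> ?; exact: pivoted.
have il : i != l by apply: contra_neq Bli => <-.
(* [T 1] adds row [l] to row [i], which brings [B l i] to the pivot position. As [l <= i], it fixes
   the basis vectors beyond [i], so the standard columns survive. *)
pose T c : 'M[F]_k := 1%:M + c *: delta_mx i l.
have TB x : T x *m B = B + x *: (delta_mx i l *m B).
  by rewrite mulmxDl mul1mx -scalemxAl.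
have TT : T (-1) *m T 1 = 1%:M.
  rewrite /T mulmxDl mul1mx mulmxDr mulmx1 -scalemxAl -scalemxAr.
  by rewrite mul_delta_mx_0 1?eq_sym // !scaler0 addr0 scaleN1r scale1r addrK.
have uT : T 1 \in unitmx by case/mulmx1_unit: TT.
rewrite -[B]mul1mx -TT -mulmxA; apply: (GM _ _); first exact: Gt.
apply: pivoted.
- by rewrite unitmx_mul uT.
- rewrite TB scale1r mxE Bii add0r mxE (bigD1 l) //= mxE !eqxx mul1r.
  by rewrite big1 ?addr0 // => m /negPf ml; rewrite mxE ml andbF mul0r.
- move=> m im; rewrite -mulmxA stdB // mulmxDl mul1mx -scalemxAl.
  rewrite mul_delta_mx_0 ?scaler0 ?addr0 //.
  by apply: contraTneq im => <-; rewrite -leqNgt.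
Qed.

End ElementaryMatrices.

(** * Gram-Schmidt and the determinant identity for pairs of frames *)

Section Orthonormal.
Variable R : realType.

Lemma dotmx_eq0 n (x : 'rV[R]_n) : (x *m x^T) 0 0 = 0 -> x = 0.
Proof.
rewrite mxE => /eqP; rewrite psumr_eq0 => [/allP x0|i _]; last by rewrite mxE -expr2 sqr_ge0.
apply/rowP => i; have := x0 i (mem_index_enum _).
by rewrite !mxE /= -expr2 sqrf_eq0 => /eqP.
Qed.

Lemma dotmx_ge0 n (x : 'rV[R]_n) : 0 <= (x *m x^T) 0 0.
Proof. by rewrite mxE sumr_ge0 // => i _; rewrite mxE -expr2 sqr_ge0. Qed.

(** Rows are orthonormalised from the bottom up: the top row [m] loses its projection onto the span
    of the lower rows, and the remainder [m0] is normalised. *)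
Lemma gram_schmidt k n (M : 'M[R]_(k, n)) : row_free M ->
  exists (T : 'M[R]_k) (Q : 'M[R]_(k, n)),
    [/\ T \in unitmx, Defs.orthonormal Q & M = T *m Q].
Proof.
elim: k M => [|k IHk] M freeM.
  exists 1%:M, M; split; rewrite ?unitmx1 ?mul1mx //.
  by rewrite /Defs.orthonormal; apply/matrixP => -[].
rewrite -[k.+1]/(1 + k)%N in M freeM *.
have freeD : row_free (dsubmx M).
  apply/row_freeP; have /row_freeP[N MN] := freeM.
  exists (rsubmx N); move: MN.
  rewrite -{1}(vsubmxK M) -{1}(hsubmxK N) mul_col_row.
  by rewrite (@scalar_mx_block _ 1 k 1) => /eq_block_mx[].
have [T [Q [uT oQ DQ]]] := IHk _ freeD.
pose m := usubmx M; pose m0 := m - m *m Q^T *m Q.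
have m0Q : m0 *m Q^T = 0.
  by rewrite mulmxBl -!mulmxA oQ mulmx1 subrr.
have m0n0 : m0 != 0.
  (* If [m0] vanished, [m] would be a combination of the lower rows, and the row vector below would
     be a nontrivial linear relation among the rows of [M]. *)
  apply/eqP => /eqP; rewrite subr_eq0 => /eqP mQ.
  have : row_mx 1%:M (- (m *m Q^T *m invmx T)) *m M = 0.
    rewrite -[in LHS](vsubmxK M) mul_row_col mul1mx -/m DQ {1}mQ.
    by rewrite mulNmx !mulmxA mulmxKV // subrr.
  rewrite -[RHS](mul0mx _ M) => /(row_free_inj freeM) /(congr1 lsubmx).
  rewrite row_mxKl linear0 => /matrixP /(_ 0 0) /eqP.
  by rewrite !mxE eqxx oner_eq0.
pose d := Num.sqrt ((m0 *m m0^T) 0 0).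
have d2 : d ^+ 2 = (m0 *m m0^T) 0 0 by rewrite sqr_sqrtr // dotmx_ge0.
have d0 : d != 0.
  by apply: contra_neq m0n0 => d0; apply: dotmx_eq0; rewrite -d2 d0 expr0n.
have Qm0 : Q *m m0^T = 0 by rewrite -[LHS]trmxK trmx_mul trmxK m0Q trmx0.
(* The first block row encodes [m = d (m0 / d) + (m Q^T) Q]. *)
exists (block_mx d%:M (m *m Q^T) 0 T), (col_mx (d^-1 *: m0) Q); split.
- by rewrite unitmxE det_ublock det_scalar expr1 unitrM unitfE d0 -unitmxE.
- rewrite /Defs.orthonormal tr_col_mx mul_col_row linearZ /= -!scalemxAr -!scalemxAl.
  rewrite Qm0 m0Q oQ !scaler0 (@scalar_mx_block _ 1 k 1); congr block_mx.
  apply/matrixP => a b; rewrite !ord1 !mxE eqxx mulr1n.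
  have -> : \sum_i m0 0 i * m0^T i 0 = d ^+ 2 by rewrite d2 mxE.
  by rewrite expr2 mulKf // mulVf.
- rewrite mul_block_col mul0mx add0r -DQ mul_scalar_mx scalerA mulfV // scale1r.
  by rewrite subrK vsubmxK.
Qed.

Lemma det_orthonormal n (P : 'M[R]_n) : Defs.orthonormal P -> `|\det P| = 1.
Proof.
move=> /(congr1 determinant); rewrite det_mulmx det_tr det1 -expr2 => dP.
by apply/eqP; rewrite -sqrp_eq1 // real_normK ?dP // num_real.
Qed.

Lemma det_frames p q n (P P' : 'M[R]_(p, n)) (Q Q' : 'M[R]_(q, n))
    (A : 'M[R]_n) (S : 'M[R]_p) (T : 'M[R]_q) :
  (p + q = n)%N -> A \in unitmx ->
  Defs.orthonormal P -> Defs.orthonormal Q -> P *m Q^T = 0 ->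
  Defs.orthonormal P' -> Defs.orthonormal Q' -> P' *m Q'^T = 0 ->
  P *m (invmx A)^T = S *m P' -> Q *m A = T *m Q' ->
  `|\det T| = `|\det A| * `|\det S|.
Proof.
(* Replacing [n] by [p + q] makes the stacked frames [col_mx P Q] and [col_mx P' Q'] square. *)
move=> pqn; case: n / pqn in P P' Q Q' A * => uA oP oQ PQ oP' oQ' PQ' ES ET.
have ortho (X : 'M[R]_(p, p + q)) (Y : 'M[R]_(q, p + q)) :
    Defs.orthonormal X -> Defs.orthonormal Y -> X *m Y^T = 0 ->
    Defs.orthonormal (col_mx X Y).
  move=> oX oY XY; rewrite /Defs.orthonormal tr_col_mx mul_col_row oX oY XY.
  by rewrite -[Y *m _]trmxK trmx_mul trmxK XY trmx0 -scalar_mx_block.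
have Q'P' : Q' *m P'^T = 0 by rewrite -[LHS]trmxK trmx_mul trmxK PQ' trmx0.
have inv1 : P *m A *m P'^T *m S^T = 1%:M.
  rewrite -!mulmxA -trmx_mul -ES trmx_mul trmxK !mulmxA mulmxK //.
(* The right factor turns the upper left block, which by [inv1] is a left inverse of [S^T], into the
   identity. The lower left block vanishes because [Q' P'^T = 0]. *)
have : (col_mx P Q *m A *m (col_mx P' Q')^T) *m block_mx S^T 0 0 1%:M =
    block_mx 1%:M (P *m A *m Q'^T) 0 T.
  rewrite mul_col_mx tr_col_mx mul_col_row mulmx_block !mulmx0 !mulmx1.
  rewrite !add0r !addr0 inv1 ET -(mulmxA T Q' P'^T) Q'P' mulmx0 mul0mx.
  by rewrite -(mulmxA T Q' Q'^T) oQ' mulmx1.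
move=> /(congr1 (fun M => `|\det M|)).
rewrite !det_mulmx !det_ublock !normrM !det_tr.
rewrite (det_orthonormal (ortho _ _ oP oQ PQ)) (det_orthonormal (ortho _ _ oP' oQ' PQ')).
by rewrite !det1 normr1 !mulr1 !mul1r => <-.
Qed.

End Orthonormal.

(** * Monotonicity and countable subadditivity of the outer volume *)

Section OuterVolume.
Variables (R : realType) (k : nat).
Implicit Types (S : set 'rV[R]_k) (a b : 'rV[R]_k).

Definition boxvol a b : R := \prod_(i < k) (b ord0 i - a ord0 i).

Lemma boxvol_ge0 a b : (forall i, a ord0 i <= b ord0 i) -> 0 <= boxvol a b.
Proof. by move=> ab; apply: prodr_ge0 => i _; rewrite subr_ge0. Qed.

Lemma lvol_ge0 S : (0 <= lvol S)%E.
Proof.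
apply: le_ereal_inf_tmp => _ [a [b [ab _ ->]]].
by apply: nneseries_ge0 => m _ _; rewrite lee_fin boxvol_ge0.
Qed.

Lemma le_lvol S S' : S `<=` S' -> (lvol S <= lvol S')%E.
Proof.
move=> SS'; apply: ereal_inf_le_tmp => v [a [b [ab cov ->]]].
by exists a, b; split => //; exact: subset_trans cov.
Qed.

(** The box is padded to an infinite cover by degenerate boxes at the origin. Their volume is 0
    because [0 < k]; in dimension 0 the empty product would be 1. *)
Lemma lvol_box_le a b : (0 < k)%N -> (forall i, a ord0 i <= b ord0 i) ->
  (lvol (box a b) <= (boxvol a b)%:E)%E.
Proof.
move=> k0 ab; apply: ereal_inf_lbound.
pose c m : 'rV[R]_k := if m == 0%N then a else 0.
pose d m : 'rV[R]_k := if m == 0%N then b else 0.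
have cd m i : c m ord0 i <= d m ord0 i by rewrite /c /d; case: eqP.
exists c, d; split => //; first by move=> x ?; exists 0%N.
rewrite (nneseries_split _ 1) => [|m _]; last by rewrite lee_fin boxvol_ge0.
rewrite add0n big_nat1 eseries0 ?adde0 // => m m0 _.
by rewrite (bigD1 (Ordinal k0)) //= /c /d gtn_eqF // subrr mul0r.
Qed.

Lemma lvol_set0 : (0 < k)%N -> lvol (set0 : set 'rV[R]_k) = 0%E.
Proof.
move=> k0; apply/eqP; rewrite eq_le lvol_ge0 andbT.
have -> : (0%E : \bar R) = (boxvol 0 0)%:E.
  by rewrite /boxvol (bigD1 (Ordinal k0)) //= subrr mul0r.
by apply: le_trans (lvol_box_le k0 _) => //; exact: le_lvol.
Qed.

(** When all terms are finite, choose for each [S m] a cover within [e / 2 ^ m.+1] of its volume,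
    and merge these covers into one sequence along a bijection from [nat] to [nat * nat]. *)
Lemma lvol_sigma_subadditive (S : nat -> set 'rV[R]_k) :
  (lvol (\bigcup_m S m) <= \sum_(0 <= m <oo) lvol (S m))%E.
Proof.
have [[i ioo]|] := pselect (exists i, lvol (S i) = +oo%E).
  rewrite (eseries_pinfty _ _ ioo) ?leey// => m _.
  by rewrite -ltNye (lt_le_trans _ (lvol_ge0 _)).
rewrite -forallNE => Soo; apply/lee_addgt0Pr => e e0.
rewrite (le_trans _ (epsilon_trick _ _ (ltW e0)))//; last first.
  by move=> m; exact: lvol_ge0.
pose P m (B : nat -> 'rV[R]_k * 'rV[R]_k) :=
  [/\ forall p i, (B p).1 ord0 i <= (B p).2 ord0 i,
      S m `<=` \bigcup_p box (B p).1 (B p).2 &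
      (\sum_(0 <= p <oo) (boxvol (B p).1 (B p).2)%:E <=
       lvol (S m) + (e / (2 ^ m.+1)%:R)%:E)%E].
have [B PB] : {B : nat -> nat -> 'rV[R]_k * 'rV[R]_k & forall m, P m (B m)}.
  apply: (@choice _ _ P) => m.
  have finS : lvol (S m) \is a fin_num.
    by rewrite fin_numE gt_eqF ?(lt_le_trans _ (lvol_ge0 _))//; exact/eqP/Soo.
  have em : 0 < e / (2 ^ m.+1)%:R by rewrite divr_gt0 // ltr0n expn_gt0.
  have [_ [a [b [ab cov ->]]] lt] := lb_ereal_inf_adherent em finS.
  by exists (fun p => (a p, b p)); split => //; exact: ltW.
pose v (p : nat * nat) : \bar R := (boxvol (B p.1 p.2).1 (B p.1 p.2).2)%:E.
have v0 p : (0 <= v p)%E by rewrite lee_fin boxvol_ge0 //; case: (PB p.1).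
pose rowsum i : \bar R := (\sum_(0 <= j <oo) v (i, j))%E.
have rowsum_ge0 i : (0 <= rowsum i)%E by apply: nneseries_ge0.
apply: (@le_trans _ _ (\sum_(0 <= i <oo) rowsum i)%E); last first.
  by apply: lee_nneseries => m _ //; case: (PB m).
have /card_esym/ppcard_eqP[f] := card_nat2.
have -> : (\sum_(0 <= i <oo) rowsum i = \sum_(0 <= i <oo) v (f i))%E.
  rewrite nneseries_esumT // nneseries_esumT //.
  under eq_esum => i _ do rewrite /rowsum nneseries_esumT //.
  rewrite esum_esum // (_ : _ `*`` _ = setT); last by apply/seteqP; split.
  rewrite (reindex_esum setT _ f); last exact: 'bij_f.
  by apply: eq_esum => i _; rewrite -surjective_pairing.
apply: ereal_inf_lbound.
exists (fun p => (B (f p).1 (f p).2).1), (fun p => (B (f p).1 (f p).2).2); split => //.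
  by move=> p; case: (PB (f p).1).
move=> x [m _]; have [_ cov _] := PB m => /cov[p _ xp].
by exists (f^-1%FUN (m, p)) => //; rewrite invK ?inE.
Qed.

Lemma lvol_subadditive N S (S_ : nat -> set 'rV[R]_k) : (0 < k)%N ->
  S `<=` \bigcup_(m in `I_N) S_ m -> (lvol S <= \sum_(0 <= m < N) lvol (S_ m))%E.
Proof.
move=> k0 SS.
pose U m := if (m < N)%N then S_ m else set0.
apply: (@le_trans _ _ (lvol (\bigcup_m U m))).
  by apply: le_lvol => x /SS[m /= mN xm]; exists m => //; rewrite /U mN.
apply: le_trans (lvol_sigma_subadditive _) _.
rewrite (nneseries_split _ N) => [|m _]; last exact: lvol_ge0.
rewrite add0n eseries0 ?adde0 => [|m Nm _]; last first.
  by rewrite /U ltnNge Nm lvol_set0.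
rewrite big_nat [leRHS]big_nat; apply: lee_sum => m /andP[_ mN].
by rewrite /U mN.
Qed.

(** * Scaling of the outer volume under linear maps *)

Lemma lvol_image_le (f : 'rV[R]_k -> 'rV[R]_k) (d : R) : 0 < d ->
  (* The images of the boxes of a cover again cover the image, so countable subadditivity extends a
     bound on boxes to all sets. *)
  (forall a b, (forall i, a ord0 i <= b ord0 i) ->
    (lvol (f @` box a b) <= (d * boxvol a b)%:E)%E) ->
  forall S, (lvol (f @` S) <= d%:E * lvol S)%E.
Proof.
move=> d0 fbox S; rewrite -lee_pdivrMl //; apply: le_ereal_inf_tmp.
move=> _ [a [b [ab cov ->]]]; rewrite lee_pdivrMl //.
rewrite -nneseriesZl => [|m _]; last by rewrite lee_fin boxvol_ge0.
apply: (@le_trans _ _ (lvol (\bigcup_m (f @` box (a m) (b m))))).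
  by apply: le_lvol => _ [x /cov[m _ xm] <-]; exists m => //; exists x.
apply: le_trans (lvol_sigma_subadditive _) _.
apply: lee_nneseries => [m _ _|m _]; first exact: lvol_ge0.
by rewrite -EFinM; exact: fbox.
Qed.

Lemma mul_elementary i l c (x : 'rV[R]_k) m :
  (x *m (1%:M + c *: delta_mx i l)) ord0 m = x ord0 m + c * x ord0 i *+ (m == l).
Proof.
rewrite mulmxDr mulmx1 -scalemxAr !mxE (bigD1 i) //= mxE eqxx /=.
rewrite big1 ?addr0 => [|q /negPf qi]; last by rewrite mxE qi mulr0.
by case: eqP => _; rewrite ?mulr1 ?mulr0 ?mulr1n ?mulr0n.
Qed.

Lemma mem_slice (N : nat) (p h x : R) : p <= x <= p + N.+1%:R * h ->
  exists2 s, (s < N.+1)%N & p + s%:R * h <= x <= p + s.+1%:R * h.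
Proof.
elim: N => [|N IHN]; first by exists 0%N; rewrite // mul0r addr0.
move=> /andP[px xp]; have [xN|/ltW Nx] := leP x (p + N.+1%:R * h).
  have [|s sN H] := IHN; first by rewrite px.
  by exists s => //; exact: ltnW.
by exists N.+1 => //; rewrite Nx.
Qed.

(* Cutting the box into thin slices orthogonal to the i-th axis, the sheared
   slices fit into boxes whose total volume exceeds that of the box by O(1/N). *)
Lemma lvol_transvection_box i l c a b : i != l -> (forall m, a ord0 m <= b ord0 m) ->
  (lvol [set x *m (1%:M + c *: delta_mx i l) | x in box a b] <= (boxvol a b)%:E)%E.
Proof.
move=> il ab; have k0 : (0 < k)%N by case: (k) i {l il} => [[]|].
pose w m := b ord0 m - a ord0 m.
have w0 m : 0 <= w m by rewrite subr_ge0.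
pose V := \prod_(m < k | (m != i) && (m != l)) w m.
have V0 : 0 <= V by apply: prodr_ge0.
have volE (u v : 'rV[R]_k) : (forall m, m != i -> m != l -> v ord0 m - u ord0 m = w m) ->
    boxvol u v = (v ord0 i - u ord0 i) * ((v ord0 l - u ord0 l) * V).
  move=> uv; rewrite /boxvol (bigD1 i) //= (bigD1 l) 1?eq_sym //=.
  by congr (_ * (_ * _)); apply: eq_bigr => m /andP[]; exact: uv.
(* With [N.+1] slices of thickness [h = w i / N.+1], the enclosing boxes have total volume
   [w i * (w l + 2 |c| h) * V], which exceeds that of the box by [C / N.+1]. *)
pose C := 2 * `|c| * w i ^+ 2 * V.
have C0 : 0 <= C by rewrite !mulr_ge0 // sqr_ge0.
have bound N : (lvol [set x *m (1%:M + c *: delta_mx i l) | x in box a b] <=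
    (boxvol a b + C / N.+1%:R)%:E)%E.
  pose h := w i / N.+1%:R.
  have h0 : 0 <= h by rewrite divr_ge0.
  pose p s := a ord0 i + s%:R * h.
  (* On slice [s] the shear moves coordinate [l] by [c * x i], which differs from [c * p s] by at
     most [|c| h]; hence the margin on both sides. *)
  pose u s : 'rV[R]_k := \row_m if m == i then p s else
    if m == l then a ord0 l + c * p s - `|c| * h else a ord0 m.
  pose v s : 'rV[R]_k := \row_m if m == i then p s.+1 else
    if m == l then b ord0 l + c * p s + `|c| * h else b ord0 m.
  have pS s : p s.+1 = p s + h by rewrite /p -natr1; ring.
  have li : (l == i) = false by rewrite eq_sym (negPf il).
  have uv s m : u s ord0 m <= v s ord0 m.
    rewrite !mxE; case: eqP => _; first by rewrite pS lerDl.
    case: eqP => // _; have := ab l; have : 0 <= `|c| * h by rewrite mulr_ge0.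
    lra.
  apply: le_trans (lvol_subadditive (N := N.+1) (S_ := fun s => box (u s) (v s)) k0 _) _.
    move=> _ [x xab <-].
    have [|s sN /andP[px xp]] := @mem_slice N (a ord0 i) h (x ord0 i).
      have -> : a ord0 i + N.+1%:R * h = b ord0 i; last exact: xab.
      by rewrite /h mulrCA divff // mulr1 /w addrC subrK.
    exists s => //= m; rewrite mul_elementary !mxE.
    case: (eqVneq m i) => [->|mi]; first by rewrite (negPf il) addr0 px xp.
    case: (eqVneq m l) => [->|ml]; last by rewrite addr0; exact: xab.
    rewrite mulr1n; have /andP[al bl] := xab l.
    have : `|c * (x ord0 i - p s)| <= `|c| * h.
      rewrite normrM ler_wpM2l // ger0_norm ?subr_ge0 // lerBlDl -pS //.
    rewrite ler_norml mulrBr => /andP[? ?]; apply/andP; split; lra.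
  apply: (@le_trans _ _ (\sum_(0 <= s < N.+1) (h * ((w l + 2 * `|c| * h) * V))%:E)%E).
    apply: lee_sum => s _; apply: le_trans (lvol_box_le k0 (uv s)) _.
    rewrite lee_fin (volE (u s) (v s)) => [|m /negPf mi /negPf ml]; last first.
      by rewrite !mxE mi ml.
    rewrite !mxE !eqxx li pS; rewrite le_eqVlt /w; apply/orP; left; apply/eqP; ring.
  rewrite sumEFin lee_fin sumr_const_nat subn0 (volE a b) // -/(w i) -/(w l).
  rewrite /C -[leLHS]mulr_natr /h le_eqVlt; apply/orP; left; apply/eqP.
  have : N.+1%:R != 0 :> R by rewrite pnatr_eq0.
  move: (N.+1%:R) => q q0.
  by field.
apply/lee_addgt0Pr => e e0; pose N := Num.truncn (C / e).
apply: le_trans (bound N) _; rewrite -EFinD lee_fin lerD2l.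
rewrite ler_pdivrMr // mulrC -ler_pdivrMr // ltW //.
exact: truncnS_gt.
Qed.

Lemma lvol_dilation_box i c a b : c != 0 -> (forall m, a ord0 m <= b ord0 m) ->
  (lvol [set x *m (1%:M + (c - 1)%R *: delta_mx i i) | x in box a b] <=
   (`|c| * boxvol a b)%:E)%E.
Proof.
move=> c0 ab; have k0 : (0 < k)%N by case: (k) i => [[]|].
(* A negative [c] reverses the interval on axis [i], so its new ends are a minimum and a maximum. *)
pose u : 'rV[R]_k := \row_m if m == i then Num.min (c * a ord0 i) (c * b ord0 i) else a ord0 m.
pose v : 'rV[R]_k := \row_m if m == i then Num.max (c * a ord0 i) (c * b ord0 i) else b ord0 m.
have uv m : u ord0 m <= v ord0 m.
  by rewrite !mxE; case: eqP => // _; rewrite ge_min le_max lexx.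
have -> : `|c| * boxvol a b = boxvol u v.
  rewrite /boxvol !(bigD1 i (P := xpredT)) //= mulrA !mxE eqxx; congr (_ * _).
    rewrite -[b _ _ - _]ger0_norm ?subr_ge0 // -normrM mulrBr.
    by rewrite maxr_absE minr_absE distrC; field.
  by apply: eq_bigr => m /negPf mi; rewrite !mxE mi.
apply: le_trans (lvol_box_le k0 uv); apply: le_lvol => _ [x xab <-] m.
rewrite mul_elementary !mxE; case: eqP => [->|_]; last by rewrite addr0.
rewrite mulr1n mulrBl mul1r addrC subrK ge_min le_max.
have /andP[ax xb] := xab i; case: (ltgtP c 0) c0 => // c0 _.
  by rewrite !(ler_nM2l c0) ax xb orbT.
by rewrite !(ler_pM2l c0) ax xb orbT.
Qed.

Lemma lvol_mulmx_le (B : 'M[R]_k) S : (0 < k)%N -> B \in unitmx ->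
  (lvol [set x *m B | x in S] <= `|\det B|%:E * lvol S)%E.
Proof.
move=> k0 uB; move: B uB S.
(* Quantifying over [S] inside the property lets the product case apply the bound for [B] to the
   image of [S] under [A]. *)
apply: (@unitmx_ind _ _ (fun B => forall S,
  (lvol [set x *m B | x in S] <= `|\det B|%:E * lvol S)%E)).
- move=> S; rewrite det1 normr1 mul1e; apply: le_lvol => _ [x Sx <-].
  by rewrite mulmx1.
- move=> A B HA HB S; rewrite det_mulmx mulrC normrM EFinM -muleA.
  apply: (@le_trans _ _ (lvol [set x *m B | x in [set x *m A | x in S]])).
    apply: le_lvol => _ [x Sx <-]; exists (x *m A); last by rewrite mulmxA.
    by exists x.
  by apply: le_trans (HB _) _; apply: lee_wpmul2l; rewrite ?lee_fin.
- move=> i l c il S; rewrite det_elementary (negPf il) addr0 normr1.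
  apply: lvol_image_le => // a b ab; rewrite mul1r.
  exact: lvol_transvection_box.
- move=> i c c0 S; rewrite det_elementary.
  have -> : 1 + (c - 1) *+ (i == i) = c by rewrite eqxx addrC subrK.
  apply: lvol_image_le; first by rewrite normr_gt0.
  by move=> a b; exact: lvol_dilation_box.
Qed.

(** The reverse inequality is the bound for [invmx B] applied to the image of [S]. *)
Lemma lvol_mulmx (B : 'M[R]_k) S : (0 < k)%N -> B \in unitmx ->
  lvol [set x *m B | x in S] = (`|\det B|%:E * lvol S)%E.
Proof.
move=> k0 uB; apply/eqP; rewrite eq_le lvol_mulmx_le //=.
have dB : 0 < `|\det B| by rewrite normr_gt0 -unitfE -unitmxE.
rewrite -lee_pdivlMl // -normfV -det_inv.
apply: le_trans (lvol_mulmx_le _ k0 _); last by rewrite unitmx_inv.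
apply: le_lvol => x Sx; exists (x *m B); last by rewrite mulmxK.
by exists x.
Qed.

End OuterVolume.

(** * Linear images of convex bodies and of Hausdorff approximations *)

Section LinearImages.
Variables (R : realType) (n : nat).
Implicit Types (A B : 'M[R]_n) (K L M : set 'rV[R]_n).

Lemma mulmxr_continuous B : continuous (fun x : 'rV[R]_n => x *m B).
Proof.
move=> x U [P xP PU].
have near_coord l : \forall y \near x, P 0 l ((y *m B) 0 l).
  have : (y *m B) 0 l @[y --> x] --> (x *m B) 0 l.
    rewrite mxE; under eq_fun do rewrite mxE.
    apply: (cvg_big _ (nbhs_filter x)) => [|i _]; first exact: add_continuous.
    apply: (@cvgM _ _ _ (nbhs_filter x)); first exact: coord_continuous.
    exact: cvg_cst.
  by move=> /(_ _ (xP 0 l)).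
have : \forall y \near x, forall l, P 0 l ((y *m B) 0 l).
  exact: (filter_forall (nbhs_filter x)).
apply: (@filterS _ _ (nbhs_filter x)) => y Py; apply: PU => i l; rewrite ord1; exact: Py.
Qed.

Lemma lin_image_compact A K : compact K -> compact (lin_image A K).
Proof.
apply: continuous_compact; apply: continuous_subspaceT.
exact: mulmxr_continuous.
Qed.

Lemma lin_image_convex A K : Defs.convex_set K -> Defs.convex_set (lin_image A K).
Proof.
move=> cK _ _ t [x Kx <-] [y Ky <-] t01.
by exists (t *: x + (1 - t) *: y); [exact: cK|rewrite mulmxDl -!scalemxAl].
Qed.

Lemma lin_image_os_body A K : A \in unitmx -> os_body K -> os_body (lin_image A K).
Proof.
move=> uA [cK kK sK [x0 x0K]]; split.
- exact: lin_image_convex.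
- exact: lin_image_compact.
- by move=> _ [x Kx <-]; exists (- x); [exact: sK|rewrite mulNmx].
- exists (x0 *m A^T); rewrite /interior /=.
  have uAt : A^T \in unitmx by rewrite unitmx_tr.
  (* The image of [K] is its preimage under the continuous inverse map, hence a neighbourhood of the
     image of [x0]. *)
  have : nbhs (x0 *m A^T *m invmx A^T) K by rewrite mulmxK.
  move=> /(@mulmxr_continuous (invmx A^T)); apply: (@filterS _ _ (nbhs_filter (x0 *m A^T))) => y Ky.
  by exists (y *m invmx A^T) => //; rewrite mulmxKV.
Qed.

Lemma enorm_coord (x : 'rV[R]_n) i : `|x ord0 i| <= enorm x.
Proof.
rewrite -sqrtr_sqr ler_wsqrtr // (bigD1 i) //= lerDl sumr_ge0 // => l _.
exact: sqr_ge0.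
Qed.

Lemma enorm_le_sum (x : 'rV[R]_n) : enorm x <= \sum_i `|x ord0 i|.
Proof.
have s0 : 0 <= \sum_i `|x ord0 i| by apply: sumr_ge0.
rewrite -[leRHS](ger0_norm s0) -sqrtr_sqr ler_wsqrtr //.
rewrite expr2 mulr_suml; apply: ler_sum => i _.
rewrite -real_normK ?num_real // expr2 ler_wpM2l // (bigD1 i) //= lerDl.
exact: sumr_ge0.
Qed.

Lemma enorm_mulmx_le B :
  exists2 C : R, 0 < C & forall x : 'rV[R]_n, enorm (x *m B) <= C * enorm x.
Proof.
(* The entrywise sum bounds the operator norm; the added 1 makes the constant positive, so that one
   may later divide by it. *)
exists (1 + \sum_l \sum_i `|B i l|) => [|x].
  by rewrite ltr_pwDl // sumr_ge0 // => l _; exact: sumr_ge0.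
rewrite mulrDl mul1r ler_wpDl ?sqrtr_ge0 //; apply: le_trans (enorm_le_sum _) _.
rewrite mulr_suml; apply: ler_sum => l _; rewrite mxE.
apply: le_trans (ler_norm_sum _ _ _) _; rewrite mulr_suml; apply: ler_sum => i _.
by rewrite normrM mulrC ler_wpM2l // enorm_coord.
Qed.

Lemma hausdorff_le_lin_image A : exists2 C : R, 0 < C & forall K M e,
  hausdorff_le K M e -> hausdorff_le (lin_image A K) (lin_image A M) (C * e).
Proof.
have [C C0 HC] := enorm_mulmx_le A^T; exists C => // K M e [KM MK].
split=> _ [x xK <-].
  have [y My xy] := KM _ xK; exists (y *m A^T); first by exists y.
  by rewrite -mulmxBl (le_trans (HC _)) // ler_pM2l.
have [y My xy] := MK _ xK; exists (y *m A^T); first by exists y.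
by rewrite -mulmxBl (le_trans (HC _)) // ler_pM2l.
Qed.

(** * Linear images of [j]-projection bodies and of their class *)

Lemma lvol_proj_coords k (P : 'M[R]_(k, n)) (T : 'M[R]_k) (Q : 'M[R]_(k, n)) A K :
  (0 < k)%N -> T \in unitmx -> P *m A = T *m Q ->
  lvol (proj_coords P (lin_image A K)) = (`|\det T|%:E * lvol (proj_coords Q K))%E.
Proof.
move=> k0 uT PA; rewrite -det_tr -lvol_mulmx ?unitmx_tr //; congr lvol.
have E x : x *m A^T *m P^T = x *m Q^T *m T^T by rewrite -!mulmxA -!trmx_mul PA.
apply/seteqP; split=> _ [_ [x Kx <-] <-].
  by rewrite E; exists (x *m Q^T) => //; exists x.
by rewrite -E; exists (x *m A^T) => //; exists x.
Qed.

Lemma jproj_body_lin_image j A K L :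
  (0 < j < n)%N -> A \in unitmx -> jproj_body j K L ->
  jproj_body j (lin_image A K)
    (lin_image (powR `|\det A| (1 / (n - j)%:R) *: (invmx A)^T) L).
Proof.
move=> /andP[j0 jn] uA KL P Q oP oQ PQ.
have nj0 : (0 < n - j)%N by rewrite subn_gt0.
have free_mul k (X : 'M[R]_(k, n)) B :
    Defs.orthonormal X -> B \in unitmx -> row_free (X *m B).
  move=> oX uB; apply/row_freeP; exists (invmx B *m X^T).
  by rewrite mulmxA mulmxK.
have uAt : (invmx A)^T \in unitmx by rewrite unitmx_tr unitmx_inv.
have [T [Q' [uT oQ' QA]]] := gram_schmidt (free_mul _ _ _ oQ uA).
have [S [P' [uS oP' PA]]] := gram_schmidt (free_mul _ _ _ oP uAt).
(* Since [A^-T A^T = 1], the product [S P' Q'^T T^T] equals [P Q^T = 0]; then cancel [S] and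
   [T^T]. *)
have PQ' : P' *m Q'^T = 0.
  have : S *m (P' *m Q'^T) *m T^T = 0.
    rewrite mulmxA -PA -mulmxA -trmx_mul -QA trmx_mul mulmxA -(mulmxA P).
    by rewrite -trmx_mul mulmxV // trmx1 mulmx1.
  move=> /(congr1 (mulmx^~ (invmx T^T))); rewrite mulmxK ?unitmx_tr // mul0mx.
  by move=> /(congr1 (mulmx (invmx S))); rewrite mulKmx // mulmx0.
set c := powR _ _.
have dA : 0 < `|\det A| by rewrite normr_gt0 -unitfE -unitmxE.
have c0 : 0 < c by exact: powR_gt0.
(* The frame [P] spans dimension [n - j], so the dilation by [c] contributes [c ^+ (n - j)] to the
   determinant of [c *: S]. *)
have cn : c ^+ (n - j) = `|\det A|.
  by rewrite -powR_mulrn ?powR_ge0 // -powRrM mul1r mulVf ?powRr1 // pnatr_eq0 -lt0n.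
rewrite (lvol_proj_coords _ j0 uT QA).
rewrite (@lvol_proj_coords _ P (c *: S) P') //; last 2 first.
- by rewrite unitmxZ // unitfE gt_eqF.
- by rewrite -scalemxAr PA scalemxAl.
rewrite (KL P' Q') // detZ normrM normrX (gtr0_norm c0) cn.
by rewrite (det_frames _ uA oP oQ PQ oP' oQ' PQ' PA QA) // subnK // ltnW.
Qed.

(** A linear map enlarges Hausdorff distances by at most a constant factor [C], so approximants of
    [M] within [e / C] are carried to approximants of the image within [e]. *)
Lemma jproj_class_lin_image j A M : (0 < j < n)%N -> A \in unitmx ->
  jproj_class j M -> jproj_class j (lin_image A M).
Proof.
move=> jn uA [[x Mx] kM cM approx]; split.
- by exists (x *m A^T), x.
- exact: lin_image_compact.
- exact: lin_image_convex.
have [C C0 HC] := hausdorff_le_lin_image A.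
move=> e e0; have [|K [L [bK bL KL MK]]] := approx (e / C); first exact: divr_gt0.
exists (lin_image A K),
  (lin_image (powR `|\det A| (1 / (n - j)%:R) *: (invmx A)^T) L); split.
- exact: lin_image_os_body.
- apply: lin_image_os_body => //; rewrite unitmxZ ?unitmx_tr ?unitmx_inv //.
  by rewrite unitfE gt_eqF // powR_gt0 // normr_gt0 -unitfE -unitmxE.
- exact: jproj_body_lin_image.
- by rewrite -[e](divfK (lt0r_neq0 C0)) mulrC; exact: HC.
Qed.

End LinearImages.

(** Invariance of the class is expressed as one inclusion for each invertible [A]; the inclusion for
    the inverse matrix gives the converse. *)
Theorem theorem5p1 (R : realType) (n j : nat) (A : 'M[R]_n) :
  (3 <= n)%N -> (1 <= j <= n - 1)%N -> A \in unitmx ->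
  (forall K L : set 'rV[R]_n,
      os_body K -> os_body L -> jproj_body j K L ->
      jproj_body j (lin_image A K)
        (lin_image (powR `|\det A| (1 / (n - j)%:R) *: (invmx A)^T) L)) /\
  (forall M : set 'rV[R]_n, jproj_class j M -> jproj_class j (lin_image A M)).
Proof.
move=> n3 /andP[j0 jn] uA.
have j0n : (0 < j < n)%N.
  by rewrite j0 (leq_ltn_trans jn) // ltn_subrL (leq_trans _ n3).
by split=> [K L _ _|M]; [exact: jproj_body_lin_image|exact: jproj_class_lin_image].
Qed.
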